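(* Let $k=k(n)\ge 1$ be a sequence of integers and let $D$ be the degree of a randomly chosen vertex of $\mathit{LK}(n,k)$. If $k=o(\sqrt{n})$ as $n\to\infty$, then $$\mathbb{E}[D]=k - \left[ \frac{(2k-1)}{2^{2k-1}}\binom{2k-2}{k-1} \right]\bigl(1+O(k^2/n)\bigr).$$ If moreover $k=o(n^{1/3})$ and $k\to\infty$ as $n\to\infty$, then $$\mathbb{E}[D]= k - \sqrt{\frac{k}{\pi}} + \frac{1}{8\sqrt{\pi k}} + o\left(\frac{1}{\sqrt{k}}\right).$$
   Context: The bilateral preference random graph $\mathit{LK}(n,k)$ has vertex set $[n]=\{1,\dots,n\}$ and is built as follows. Assign i.i.d. uniform $[0,1]$ weights to the $\binom n2$ edges of the complete graph on $[n]$ (almost surely distinct). The edge $(i,j)$ is present in $\mathit{LK}(n,k)$ if and only if it is among the $k$ edges of lowest weight incident to vertex $i$ and also among the $k$ edges of lowest weight incident to vertex $j$. The randomly chosen vertex is uniform on $[n]$; the expectation is over the random graph and the choice of vertex. All asymptotic notation is as $n\to\infty$. *)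

(* Defs.v *)
From HB Require Import structures.
From mathcomp Require Import all_boot all_order all_algebra.
From mathcomp Require Import all_classical all_reals all_analysis.

Set Implicit Arguments.
Unset Strict Implicit.
Unset Printing Implicit Defensive.

Import Order.TTheory GRing.Theory Num.Theory.
Import numFieldNormedType.Exports.

Local Open Scope classical_set_scope.
Local Open Scope ring_scope.

Definition edge (n : nat) := {e : {set 'I_n} | (#|e| == 2)%N}.

Definition incident n (v : 'I_n) (e : edge n) : bool := v \in val e.

Section LK.
Context (R : realType) (n : nat) (w : edge n -> R) (k : nat).

(* When the weights are distinct, [e] is among the [k] lightest edges at [v]
   iff fewer than [k] edges at [v] are lighter than [e]. Ties have probability
   zero in the model below. *)
Definition among_lowest (v : 'I_n) (e : edge n) : bool :=
  incident v e && (#|[set f : edge n | incident v f & (w f < w e)%R]%SET| < k)%N.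

Definition LK : {set edge n} :=
  [set e | [forall v, incident v e ==> among_lowest v e]]%SET.

Definition LK_degree (v : 'I_n) : nat := #|[set e in LK | incident v e]%SET|.

End LK.

Section independence.
Context d (T : measurableType d) (R : realType) (P : probability T R).

Definition mutually_independent (I : finType) (X : I -> {RV P >-> R}) : Prop :=
  forall (J : {set I}) (B : I -> set R),
    (forall i, measurable (B i)) ->
    P (\bigcap_(i in [set` J]) (X i @^-1` B i)) =
    (\prod_(i in J) P (X i @^-1` B i))%E.

Definition uniform01 (X : {RV P >-> R}) : Prop :=
  forall B : set R, measurable B ->
    distribution P X B = uniform_prob (@ltr01 R) B.

Definition sigma_of (I : Type) (X : I -> {RV P >-> R}) : set (set T) :=
  <<s [set A | exists i (B : set R), measurable B /\ A = X i @^-1` B] >>.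

End independence.

(* One realization of the randomness behind the degree of a random vertex: the
   edge weights, and a uniform vertex chosen independently of them. There is no
   such sample for [n = 0], since no vertex can then be chosen. *)
Record LK_sample (R : realType) (n : nat) := LKSample {
  sample_display : measure_display;
  sample_space : measurableType sample_display;
  sample_prob : probability sample_space R;
  weight : edge n -> {RV sample_prob >-> R};
  vertex : sample_space -> 'I_n;
  weight_uniform : forall e, uniform01 (weight e);
  weight_independent : mutually_independent weight;
  vertex_measurable : forall v, measurable (vertex @^-1` [set v]);
  vertex_uniform : forall v,
    sample_prob (vertex @^-1` [set v]) = (n%:R^-1)%:E;
  vertex_independent : forall v A, sigma_of weight A ->
    sample_prob (vertex @^-1` [set v] `&` A) =
    (sample_prob (vertex @^-1` [set v]) * sample_prob A)%E
}.

Arguments vertex {R n} _ _.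

Definition random_degree (R : realType) (n : nat) (S : LK_sample R n) (k : nat)
    : sample_space S -> R :=
  fun omega => (LK_degree (fun e => weight S e omega) k (vertex S omega))%:R.

Arguments random_degree {R n} S k _.

Definition expected_degree (R : realType) (n : nat) (S : LK_sample R n)
    (k : nat) : \bar R :=
  expectation (sample_prob S) (random_degree S k).

(* Main.v *)
Require Import Defs.
From HB Require Import structures.
From mathcomp Require Import all_boot all_order all_algebra.
From mathcomp Require Import all_classical all_reals all_analysis.
From mathcomp Require Import measurable_realfun ring lra zify.
Import Order.TTheory GRing.Theory Num.Theory.
Import numFieldNormedType.Exports.
Local Open Scope classical_set_scope.
Local Open Scope ring_scope.

(** The relative order of independent uniform weights is all that matters. An
    edge e = ij meets m = n - 2 other edges at i and m other edges at j, all
    distinct. Conditionally on w e = x, each of these 2m weights lies below x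
    with probability x, independently, so e belongs to the graph with
    probability the integral over [0, 1] of B_k ^ 2, where B_k(x) is the
    probability that a binomial variable of parameters m and x is below k, a
    sum of k Bernstein polynomials p_0, ..., p_(k-1). By linearity the expected
    degree is (m + 1) times that integral ([expected_degreeE]).

    Conditioning is avoided: on polynomials the integral is a plain linear form
    [int01], and the law of the order is determined by the probabilities that e
    is the heaviest of a given set of s + 1 edges ([max_prob]). A Riemann sum
    over cells of width 1 / N bounds these below by 1 / (s + 1), and the s + 1
    such events are disjoint, which forces equality. Any other pattern of
    comparisons with e is a difference of two simpler ones
    ([order_pattern_prob]), exactly as X^a (1 - X)^(b + 1) is the difference of
    X^a (1 - X)^b and X^(a + 1) (1 - X)^b.

    Integrating by parts, with X B_k' = - k p_k, gives for k <= m the exact value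
      E[D] = k * sum over j < k of  w_j / (2 (j + 1)),
    where w_j = 2 (m + 1) * (integral of p_j ^ 2) ([mean_degreeE]). The ratio
    w_(j+1) / w_j exceeds by the factor 1 + 1 / (2 (m - j) - 1) the ratio of
    consecutive c_j = C(2j, j) / 4^j, so that w_j / c_j lies between 1 and
    1 + 2 (j + 1) / m when 2 (j + 1) <= m. As c_j / (2 (j + 1)) = c_j - c_(j+1), replacing w_j by
    c_j turns the sum into k (1 - c_k), with an error between 0 and k ^ 2 / m
    ([mean_degree_bounds]). Since k c_k is the bracket of the first claim and is
    at least 1 / 2, the first claim follows.

    For the second, c_k is needed to second order. Comparing the primitives of
    the powers of cos at pi / 2 gives Wallis's bounds, hence
    pi k c_k ^ 2 --> 1; the sequence (k + 1/4) c_k ^ 2 increases and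
    (k + 1/4 + 1 / (32 k)) c_k ^ 2 decreases, both to 1 / pi, which yields
    k c_k = sqrt (k / pi) - 1 / (8 sqrt (pi k)) + O(k ^ (-3/2))
    ([central_expansion]). The error k ^ 2 / n is o(1 / sqrt k) because
    k ^ 3 = o(n). *)

(** * Bernstein polynomials on the unit interval *)

Section UnitIntegral.
Context {F : numFieldType}.
Implicit Types p q : {poly F}.

(** The integral of [p] over the unit interval, as a linear form on
    coefficients. *)
Definition int01 p : F := \sum_(i < size p) p`_i / i.+1%:R.

Lemma int01_widen N p : (size p <= N)%N ->
  int01 p = \sum_(i < N) p`_i / i.+1%:R.
Proof.
move=> spN; rewrite /int01 (big_ord_widen _ (fun i => p`_i / i.+1%:R) spN).
rewrite big_mkcond/=; apply: eq_bigr => i _; case: ltnP => // /leq_sizeP -> //.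
by rewrite mul0r.
Qed.

Fact int01_is_linear : linear_for *%R int01.
Proof.
move=> a p q; pose N := maxn (size p) (size q).
have sp : (size p <= N)%N by rewrite leq_maxl.
have sq : (size q <= N)%N by rewrite leq_maxr.
have spq : (size (a *: p + q)%R <= N)%N.
  rewrite (leq_trans (size_polyD _ _))// geq_max sq andbT.
  by rewrite (leq_trans (size_scale_leq _ _)).
rewrite !(int01_widen N)// mulr_sumr -big_split/=.
by apply: eq_bigr => i _; rewrite coefD coefZ mulrDl mulrA.
Qed.

HB.instance Definition _ :=
  GRing.isLinear.Build F {poly F} F *%R int01 int01_is_linear.

Lemma int01Z (c : F) p : int01 (c *: p) = c * int01 p.
Proof. exact: linearZ. Qed.

Lemma int01D p q : int01 (p + q) = int01 p + int01 q.
Proof. exact: linearD. Qed.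

Lemma int01N p : int01 (- p) = - int01 p.
Proof. exact: linearN. Qed.

Lemma int01_Xn n : int01 'X^n = n.+1%:R^-1.
Proof.
rewrite (int01_widen n.+1) ?size_polyXn// big_ord_recr/= coefXn eqxx mul1r.
rewrite big1 ?add0r// => i _.
by rewrite coefXn ltn_eqF// mul0r.
Qed.

Lemma int01_deriv p : int01 p^`() = p.[1] - p.[0].
Proof.
rewrite (int01_widen (size p).-1); last first.
  rewrite -ltnS; case: (eqVneq p 0) => [->|p0]; first by rewrite deriv0 size_poly0.
  by rewrite (leq_trans (lt_size_deriv p0)) ?leqSpred.
have -> : p.[1] - p.[0] = \sum_(i < (size p).-1) p`_i.+1.
  rewrite horner_coef0 (horner_coef_wide _ (leqSpred _)) big_ord_recl expr0.
  by rewrite mulr1 addrC addKr; apply: eq_bigr => i _; rewrite expr1n mulr1.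
by apply: eq_bigr => i _; rewrite coef_deriv -[_ *+ _]mulr_natr mulfK.
Qed.

End UnitIntegral.

Section Bernstein.
Context {F : numFieldType} (m : nat).

(** Associativity of scaling restricted to polynomials: the general laws would
    also rewrite products of scalars, as a field is a module over itself. *)
Let scale_mull (c : F) (p q : {poly F}) : (c *: p) * q = c *: (p * q).
Proof. by rewrite scalerAl. Qed.

Let scale_mulr (c : F) (p q : {poly F}) : p * (c *: q) = c *: (p * q).
Proof. by rewrite scalerAr. Qed.

Let lin := (@scale_mull, @scale_mulr, @int01D, @int01N, @int01Z).

Definition bernstein k : {poly F} := 'C(m, k)%:R *: ('X^k * (1 - 'X) ^+ (m - k)).

Definition bernstein_sum k : {poly F} := \sum_(a < k) bernstein a.

Lemma bernstein0 : bernstein 0 = (1 - 'X) ^+ m.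
Proof. by rewrite /bernstein bin0 scale1r expr0 mul1r subn0. Qed.

Lemma bernstein_sumS k : bernstein_sum k.+1 = bernstein_sum k + bernstein k.
Proof. by rewrite /bernstein_sum big_ord_recr. Qed.

Lemma mulX_deriv_XnY i j :
  'X * ('X^i * (1 - 'X) ^+ j)^`() =
  i%:R *: ('X^i * (1 - 'X) ^+ j) - j%:R *: ('X^(i.+1) * (1 - 'X) ^+ j.-1)
  :> {poly F}.
Proof.
rewrite derivM derivXn deriv_exp derivB derivX -polyC1 derivC polyC1 sub0r.
rewrite -[_ *+ i]scaler_nat -[_ *+ j]scaler_nat.
by case: i => [|i]; case: j => [|j]; rewrite /= ?scale0r -?mul_polyC ?expr0 ?exprS;
   move: 'X => X; ring.
Qed.

Lemma mulX_deriv_bernstein k :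
  'X * (bernstein k)^`() = k%:R *: bernstein k - k.+1%:R *: bernstein k.+1.
Proof.
rewrite /bernstein derivZ -scalerAr mulX_deriv_XnY scalerBr !scalerA -!natrM.
by rewrite [('C(m, k) * (m - k))%N]mulnC -mul_bin_left subnS [('C(m, k) * k)%N]mulnC.
Qed.

(** The sum of [mulX_deriv_bernstein] telescopes: this is the classical
    derivative in x of the lower tail of a binomial distribution. *)
Lemma mulX_deriv_bernstein_sum k :
  'X * (bernstein_sum k)^`() = - k%:R *: bernstein k.
Proof.
elim: k => [|k IHk].
  by rewrite /bernstein_sum big_ord0 deriv0 mulr0 oppr0 scale0r.
rewrite bernstein_sumS derivD mulrDr IHk mulX_deriv_bernstein !scaleNr.
by rewrite addrA addNr add0r.
Qed.

Lemma bernstein_at1 k : (k < m)%N -> (bernstein k).[1] = 0.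
Proof.
move=> km; rewrite /bernstein hornerZ hornerM horner_exp !hornerE subrr.
by rewrite expr0n subn_eq0 leqNgt km /= mulr0.
Qed.

Lemma bernstein_sum_at1 k : (k <= m)%N -> (bernstein_sum k).[1] = 0.
Proof.
move=> km; rewrite horner_sum big1// => i _.
by rewrite bernstein_at1// (leq_trans (ltn_ord i)).
Qed.

(** Integration by parts against ['X]; the boundary terms vanish. With
    [mulX_deriv_bernstein] it turns any product of Bernstein polynomials into a
    linear relation between such integrals. *)
Lemma int01_mulX_deriv (p : {poly F}) : p.[1] = 0 -> int01 p = - int01 ('X * p^`()).
Proof.
move=> p1; have := int01_deriv ('X * p).
rewrite !hornerM !hornerX p1 mulr0 mul0r subr0 derivM derivX mul1r int01D.
by move/eqP; rewrite addr_eq0 => /eqP.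
Qed.

Lemma int01_sqr_bernstein_sum k : (k <= m)%N ->
  int01 (bernstein_sum k ^+ 2) = 2 * k%:R * int01 (bernstein k * bernstein_sum k).
Proof.
move=> km; rewrite int01_mulX_deriv; last first.
  by rewrite horner_exp bernstein_sum_at1// expr0n.
rewrite expr2 derivM mulrDr mulrA mulX_deriv_bernstein_sum.
rewrite mulrCA mulX_deriv_bernstein_sum.
move: (bernstein k) (bernstein_sum k) => p B.
by rewrite !lin [B * p]mulrC; ring.
Qed.

Let u k : F := int01 (bernstein k ^+ 2).
Let v k : F := int01 (bernstein k * bernstein k.+1).
Let W k : F := int01 (bernstein k * bernstein_sum k).

Lemma int01_bernstein_succ k : (k < m)%N -> 2 * k.+1%:R * v k = (2 * k + 1)%:R * u k.
Proof.
move=> km; have := @int01_mulX_deriv (bernstein k ^+ 2).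
rewrite horner_exp bernstein_at1// expr0n => /(_ erefl).
rewrite expr2 derivM mulrDr mulrA mulX_deriv_bernstein mulrCA mulX_deriv_bernstein.
rewrite /u /v expr2; move: (bernstein k) (bernstein k.+1) => p q.
rewrite mulrBr mulrBl !lin.
rewrite [q * _]mulrC natrD natrM; set a := int01 (p * p); set b := int01 _ => h.
have -> : (2 * k%:R + 1) * a = a + 2 * k%:R * a by ring.
by rewrite {1}h; ring.
Qed.

(** Integrating by parts the product [bernstein k * bernstein_sum k], then
    eliminating the mixed integral with [int01_bernstein_succ]: only squares of
    Bernstein polynomials remain. *)
Lemma int01_bernstein_sumS k : (k < m)%N ->
  W k.+1 = W k + u k / (2 * k.+1%:R).
Proof.
move=> km; have := @int01_mulX_deriv (bernstein k * bernstein_sum k).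
rewrite hornerM bernstein_at1// mul0r => /(_ erefl).
rewrite derivM mulrDr mulrA mulX_deriv_bernstein mulrCA mulX_deriv_bernstein_sum.
have := int01_bernstein_succ _ km; rewrite /W /u /v bernstein_sumS expr2.
move: (bernstein k) (bernstein k.+1) (bernstein_sum k) => p q B.
rewrite mulrBl [q * (B + p)]mulrDr !lin.
rewrite [q * p]mulrC natrD natrM.
have k0 : k.+1%:R != 0 :> F by rewrite pnatr_eq0.
set a := int01 (p * p); set b := int01 (p * q); set c := int01 (q * B).
set d := int01 (p * B) => h1 h2.
have -> : b = (2 * k%:R + 1) * a / (2 * k.+1%:R).
  by rewrite -h1 mulrC mulKf ?mulf_neq0 ?pnatr_eq0.
have -> : c = (d + k%:R * d - k%:R * a) / k.+1%:R.
  by rewrite {1}h2; apply/(canRL (mulfK k0)); ring.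
apply: (mulfI k0); move: (k0); rewrite -natr1 => {}k0; by field.
Qed.

(** Integration by parts against [1 - 'X], whose boundary term is at 0. It is
    what relates consecutive squares without a third polynomial. *)
Lemma int01_mulY_deriv (p : {poly F}) :
  int01 ((1 - 'X) * p^`()) = int01 p - p.[0].
Proof.
have := int01_deriv ((1 - 'X) * p).
rewrite derivM derivB derivX -polyC1 derivC polyC1 sub0r mulN1r int01D int01N.
rewrite !hornerM !hornerE subrr mul0r subr0 mul1r sub0r => h.
by apply: (addrI (- int01 p)); rewrite h addrA addNr add0r.
Qed.

Lemma mulY_deriv_bernstein0 : (1 - 'X) * (bernstein 0)^`() = - m%:R *: bernstein 0.
Proof.
rewrite bernstein0 deriv_exp derivB derivX -polyC1 derivC polyC1 sub0r scaleNr.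
case: m => [|n]; first by rewrite mulr0n mulr0 scale0r oppr0.
by rewrite -scaler_nat -scalerAr mulrCA -exprS -scalerN mulN1r.
Qed.

Lemma mulY_deriv_bernsteinS k : (k < m)%N ->
  (1 - 'X) * (bernstein k.+1)^`() =
  (m - k)%:R *: bernstein k - (m - k.+1)%:R *: bernstein k.+1.
Proof.
move=> km; rewrite /bernstein [(m - k)%:R *: _]scalerA -natrM -mul_bin_left.
rewrite [(k.+1 * _)%N]mulnC natrM -scalerA [(m - k.+1)%:R *: _]scalerA.
rewrite [(m - k.+1)%:R * _]mulrC -scalerA -scalerBr derivZ -scalerAr.
congr (_ *: _); rewrite derivM derivXn deriv_exp derivB derivX -polyC1 derivC polyC1.
rewrite sub0r -[_ *+ k.+1]scaler_nat -[_ *+ (m - k.+1)]scaler_nat -(subnSK km).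
by case: (m - k.+1)%N => [|j]; rewrite /= ?scale0r -?mul_polyC ?expr0 ?exprS;
   move: 'X => X; ring.
Qed.

Lemma int01_sqr_bernstein0 : u 0 = (2 * m + 1)%:R^-1.
Proof.
have := int01_mulY_deriv (bernstein 0 ^+ 2).
rewrite horner_exp bernstein0 horner_exp !hornerE subr0 !expr1n -bernstein0.
rewrite expr2 derivM mulrDr mulrA mulY_deriv_bernstein0 mulrCA mulY_deriv_bernstein0.
rewrite /u expr2; move: (bernstein 0) => p.
rewrite !lin.
have m0 : (2 * m + 1)%:R != 0 :> F by rewrite pnatr_eq0 addn1.
set a := int01 (p * p) => h; apply: (mulfI m0); rewrite mulfV// natrD natrM.
transitivity (a - (- m%:R * a + - m%:R * a)); first by ring.
by rewrite h opprB addrC subrK.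
Qed.

Lemma int01_sqr_bernstein_rec k : (k < m)%N ->
  (2 * (m - k) - 1)%:R * (2 * k.+1%:R) * u k.+1 =
  2 * (m - k)%:R * (2 * k + 1)%:R * u k.
Proof.
move=> km; have := int01_mulY_deriv (bernstein k.+1 ^+ 2).
have b0 : (bernstein k.+1).[0] = 0.
  by rewrite /bernstein hornerZ hornerM horner_exp hornerX exprS mul0r mul0r mulr0.
rewrite horner_exp b0 expr0n subr0.
rewrite expr2 derivM mulrDr [(1 - 'X) * (_ * _)]mulrA mulY_deriv_bernsteinS//.
rewrite [(1 - 'X) * (_ * _)]mulrCA mulY_deriv_bernsteinS//.
have -> : 2 * (m - k)%:R * (2 * k + 1)%:R * u k = 2 * (m - k)%:R * (2 * k.+1%:R * v k).
  by rewrite (int01_bernstein_succ _ km) -mulrA.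
rewrite /u /v expr2.
move: (bernstein k) (bernstein k.+1) => p q.
rewrite mulrBr mulrBl !lin.
rewrite [q * p]mulrC; set a := int01 (q * q); set b := int01 _ => h.
have -> : (2 * (m - k) - 1)%:R = (2 * (m - k.+1) + 1)%:R :> F.
  by congr (_%:R); move: km; lia.
rewrite natrD natrM mulrDl mulrDl mul1r -[X in _ + X]mulrA -{2}h; ring.
Qed.

End Bernstein.

(** * Central binomial coefficients and the mean degree *)

Section CentralBinomial.
Context {F : realFieldType}.

(** The probability that a simple random walk is at 0 at time [2 * j]. *)
Definition central (j : nat) : F := 'C(2 * j, j)%:R / 4 ^+ j.

Lemma central0 : central 0 = 1.
Proof. by rewrite /central bin0 expr0 divr1. Qed.

Lemma centralS j : central j.+1 = central j * (2 * j + 1)%:R / (2 * j.+1%:R).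
Proof.
have h : (j.+1 * 'C(2 * j.+1, j.+1) = 2 * (2 * j + 1) * 'C(2 * j, j))%N.
  have h1 := mul_bin_diag (2 * j.+1) j.
  have h2 := mul_bin_down (2 * j).+1 j.
  rewrite /= in h2; have e : (2 * j.+1).-1 = (2 * j).+1 by lia.
  rewrite e in h1; have e2 : ((2 * j).+1 - j = j.+1)%N by lia.
  rewrite e2 in h2; nia.
have j0 : j.+1%:R != 0 :> F by rewrite pnatr_eq0.
have {}h := congr1 (fun n => n%:R : F) h; rewrite !natrM in h.
rewrite /central exprS; apply: (mulfI j0); rewrite mulrA h.
by field; rewrite nat1r expf_neq0 pnatr_eq0.
Qed.

Lemma central_gt0 j : 0 < central j.
Proof. by rewrite divr_gt0 ?exprn_gt0// ltr0n bin_gt0 mul2n -addnn leq_addr. Qed.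

Lemma central_le1 j : central j <= 1.
Proof.
elim: j => [|j IH]; first by rewrite central0.
rewrite centralS -mulrA; apply: mulr_ile1 => //; first exact/ltW/central_gt0.
by rewrite ler_pdivrMr ?mulr_gt0// mul1r -natrM ler_nat; lia.
Qed.

(** The sum telescopes, by [centralS]. *)
Lemma sum_central k : \sum_(j < k) central j / (2 * j.+1%:R) = 1 - central k.
Proof.
elim: k => [|k IH]; first by rewrite big_ord0 central0 subrr.
rewrite big_ord_recr/= IH centralS natrD natrM -[k.+1%:R]natr1; field.
by rewrite ?natr1 ?nat1r pnatr_eq0.
Qed.

Lemma central_ge k : (0 < k)%N -> 1 <= 2 * k%:R * central k.
Proof.
elim: k => // -[_ _|k IH _].
  by rewrite centralS central0; lra.
apply: le_trans (IH isT) _; rewrite [in leRHS]centralS.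
have c0 := central_gt0 k.+1; set c := central _ in c0 *.
have -> : 2 * k.+2%:R * (c * (2 * k.+1 + 1)%:R / (2 * k.+2%:R)) = c * (2 * k.+1 + 1)%:R.
  have k0 : k.+2%:R != 0 :> F by rewrite pnatr_eq0.
  by move: k.+2%:R k0 => y y0; field.
by rewrite natrD natrM; lra.
Qed.

Lemma centralE k : (0 < k)%N ->
  (2 * k - 1)%N%:R / 2 ^+ (2 * k - 1) * 'C(2 * k - 2, k - 1)%:R = k%:R * central k.
Proof.
case: k => // k _; rewrite centralS /central.
have -> : (2 * k.+1 - 1 = (2 * k).+1)%N by lia.
have -> : (2 * k.+1 - 2 = 2 * k)%N by lia.
rewrite subSS subn0 exprS exprM -[2 ^+ 2]/(2 * 2) -natrM addn1.
have f0 : 4 ^+ k != 0 :> F by rewrite expf_neq0// pnatr_eq0.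
by field; rewrite f0 ?natr1 ?nat1r pnatr_eq0.
Qed.

End CentralBinomial.

Section MeanDegree.
Context {F : realFieldType} (m : nat).

(** With [m = n - 2], the expected degree in the graph: [n - 1] possible edges
    at a vertex, each present with probability [int01 (bernstein_sum m k ^+ 2)]. *)
Definition mean_degree k : F := m.+1%:R * int01 (bernstein_sum m k ^+ 2).

(** The normalization for which [w j] tends to [central j] as [m] grows. *)
Let w j : F := 2 * m.+1%:R * int01 (bernstein m j ^+ 2).

Lemma mean_degreeE k : (k <= m)%N ->
  mean_degree k = k%:R * \sum_(j < k) w j / (2 * j.+1%:R).
Proof.
move=> km; rewrite /mean_degree int01_sqr_bernstein_sum//.
have -> : int01 (bernstein m k * bernstein_sum m k) =
    \sum_(j < k) int01 (bernstein m j ^+ 2) / (2 * j.+1%:R) :> F.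
  elim: k km => [|k IH] km; first by rewrite /bernstein_sum !big_ord0 mulr0 linear0.
  by rewrite int01_bernstein_sumS// IH ?(ltnW km)// big_ord_recr.
rewrite !mulr_sumr; apply: eq_bigr => j _; rewrite /w; ring.
Qed.

(** Induction on [j]: both sequences are multiplied by the same factor, up to
    [1 + (2 * (m - j) - 1)^-1], which is at most [1 + m^-1] as [2 * j < m]. *)
Lemma sqr_bernstein_bounds j : (2 * j.+1 <= m)%N ->
  central j <= w j <= central j * (1 + 2 * j.+1%:R / m%:R).
Proof.
elim: j => [|j IH] jm.
  have m0 : 0 < m%:R :> F by rewrite ltr0n; lia.
  rewrite central0 /w int01_sqr_bernstein0 natrD natrM -natr1 !mul1r mulr1.
  set x : F := m%:R in m0 *.
  apply/andP; split; first by rewrite ler_pdivlMr; lra.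
  rewrite ler_pdivrMr; last by lra.
  have -> : (1 + 2 / x) * (2 * x + 1) = 2 * x + 5 + 2 / x by field; rewrite gt_eqF.
  have : 0 < x^-1 by rewrite invr_gt0.
  lra.
have /IH/andP[h1 h2] : (2 * j.+1 <= m)%N by lia.
have jm' : (j < m)%N by lia.
have := @int01_sqr_bernstein_rec F m j jm'.
set u1 := int01 _; set u0 := int01 _ => h.
have hw : w j.+1 =
    w j * ((2 * j + 1)%:R / (2 * j.+1%:R)) * (1 + (2 * (m - j) - 1)%:R^-1).
  have d0 : (2 * (m - j) - 1)%:R != 0 :> F by rewrite pnatr_eq0; lia.
  have e : (m - j)%:R = ((2 * (m - j) - 1)%:R + 1) / 2 :> F.
    by rewrite natr1 (_ : (_.+1 = 2 * (m - j))%N) ?natrM; [field|lia].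
  rewrite {1}/w -/u1.
  have j0 : j.+1%:R != 0 :> F by rewrite pnatr_eq0.
  apply: (mulfI d0); apply: (mulfI j0).
  have -> : j.+1%:R * ((2 * (m - j) - 1)%:R * (2 * m.+1%:R * u1)) =
     m.+1%:R * ((2 * (m - j) - 1)%:R * (2 * j.+1%:R) * u1) by ring.
  rewrite h e /w -/u0; move: (2 * (m - j) - 1)%:R d0 j.+1%:R j0 => d d0 y y0.
  by field; rewrite d0 y0.
have q0 : 0 < (2 * j + 1)%:R / (2 * j.+1%:R) :> F.
  by rewrite divr_gt0 ?mulr_gt0 ?ltr0n// addn1.
have w0 : 0 < w j by rewrite (lt_le_trans _ h1)// central_gt0.
rewrite hw centralS -[central j * _ / _]mulrA; set q : F := _ / _ in q0 *.
have d0 : 0 < (2 * (m - j) - 1)%:R^-1 :> F by rewrite invr_gt0 ltr0n; lia.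
have dm : (2 * (m - j) - 1)%:R^-1 <= m%:R^-1 :> F.
  by rewrite lef_pV2 ?posrE ?ltr0n ?ler_nat; lia.
move: ((2 * (m - j) - 1)%:R^-1) d0 dm => d d0 dm.
apply/andP; split.
  apply: (le_trans (y := w j * q)); first by rewrite ler_wpM2r// ltW.
  by rewrite ler_peMr ?(mulr_ge0 (ltW w0) (ltW q0))//; lra.
set x : F := m%:R in h2 dm *; set y : F := j.+1%:R in h2 *.
have -> : j.+2%:R = y + 1 by rewrite natr1.
have m0 : 0 < x^-1 by rewrite invr_gt0 ltr0n; lia.
apply: (le_trans (y := central j * (1 + 2 * y / x) * q * (1 + x^-1))).
  apply: ler_pM; rewrite ?(mulr_ge0 (ltW w0) (ltW q0))//; [lra| |lra].
  by rewrite ler_wpM2r// ltW.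
have -> : central j * (1 + 2 * y / x) * q * (1 + x^-1) =
   central j * q * ((1 + 2 * y / x) * (1 + x^-1)) by ring.
rewrite ler_wpM2l ?(mulr_ge0 (ltW (central_gt0 _)) (ltW q0))//.
have yx : 2 * y / x <= 1.
  by rewrite ler_pdivrMr ?mul1r -?natrM ?ler_nat ?ltr0n; lia.
have : (2 * y / x) * x^-1 <= x^-1 by rewrite ger_pMl.
have -> : (2 * (y + 1) / x) = 2 * y / x + 2 * x^-1 by ring.
set z := 2 * y / x; set t := x^-1; lra.
Qed.

(** The weight [1 / (2 * j.+1)] of the sum cancels the growth of the relative
    error of [w j], so each of the [k] terms errs by at most [1 / m]. *)
Lemma mean_degree_bounds k : (2 * k <= m)%N ->
  0 <= mean_degree k - (k%:R - k%:R * central k) <= k%:R ^+ 2 / m%:R.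
Proof.
move=> km; have km' : (k <= m)%N by lia.
rewrite mean_degreeE// -[X in X - _ * central k]mulr1 -mulrBr -sum_central.
rewrite -mulrBr -sumrB.
have b (j : 'I_k) : 0 <= w j / (2 * j.+1%:R) - central j / (2 * j.+1%:R) <= m%:R^-1.
  have /sqr_bernstein_bounds/andP[h1 h2] : (2 * j.+1 <= m)%N by have := ltn_ord j; lia.
  have j0 : 0 < 2 * j.+1%:R :> F by rewrite mulr_gt0.
  rewrite -mulrBl divr_ge0 ?subr_ge0 ?(ltW j0)//= ler_pdivrMr// lerBlDl.
  apply: (le_trans h2); rewrite mulrDr mulr1 lerD2l [leRHS]mulrC.
  by rewrite ger_pMl ?central_le1// divr_gt0// ltr0n; have := ltn_ord j; lia.
apply/andP; split.
  by rewrite mulr_ge0// sumr_ge0// => j _; case/andP: (b j).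
rewrite expr2 -mulrA ler_wpM2l//.
apply: (le_trans (y := \sum_(j < k) m%:R^-1)).
  by apply: ler_sum => j _; case/andP: (b j).
by rewrite sumr_const card_ord -[leLHS]mulr_natl.
Qed.

End MeanDegree.

(** * The Wallis product to second order *)

Section Wallis.
Context {R : realType}.

(** The primitive of [cos ^+ n] that vanishes at 0, by the usual reduction
    formula; its value at [pi / 2] is the Wallis integral. *)
Fixpoint cos_prim (n : nat) (x : R) : R :=
  match n with
  | 0 => x
  | 1 => sin x
  | p.+2 => (cos x ^+ p.+1 * sin x + p.+1%:R * cos_prim p x) / p.+2%:R
  end.

Lemma is_derive_cos_prim n (x : R) : is_derive x 1 (cos_prim n) (cos x ^+ n).
Proof.
suff : is_derive x 1 (cos_prim n) (cos x ^+ n) /\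
       is_derive x 1 (cos_prim n.+1) (cos x ^+ n.+1) by case.
elim: n => [|n [IH0 IH1]].
  by split; rewrite ?expr0 ?expr1; [exact: is_derive_id|exact: is_derive_sin].
split => //.
have dX := is_deriveX n.+1 (is_derive_cos x).
have dM := is_deriveM dX (is_derive_sin x).
have dT := is_deriveZ n.+2%:R^-1 (is_deriveD dM (is_deriveZ n.+1%:R IH0)).
have -> : cos_prim n.+2 =
    n.+2%:R^-1 \*: (cos ^+ n.+1 * sin + n.+1%:R \*: cos_prim n).
  apply/funext => y /=.
  rewrite [RHS]/(n.+2%:R^-1 * ((cos ^+ n.+1 * sin) y + n.+1%:R * cos_prim n y)).
  rewrite mulrC; congr (_ * (_ + _)).
  by rewrite [RHS]/((cos ^+ n.+1) y * sin y) exprfctE.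
apply: (is_derive_eq dT).
have -> : (cos ^+ n.+1) x = cos x ^+ n.+1 by rewrite exprfctE.
rewrite -[LHS]/(n.+2%:R^-1 * (cos x ^+ n.+1 * cos x
  + sin x * (n.+1%:R * cos x ^+ n * - sin x) + n.+1%:R * cos x ^+ n)).
have n0 : n.+2%:R != 0 :> R by rewrite pnatr_eq0.
apply: (mulfI n0); rewrite mulVKf//.
transitivity (cos x ^+ n.+2 + n.+1%:R * cos x ^+ n * (1 - sin x ^+ 2)).
  by rewrite !exprS; ring.
by rewrite -cos2sin2 [n.+2%:R]mulrS mulrDl mul1r -mulrA -exprD addn2.
Qed.

Lemma cos_prim_at0 n : cos_prim n 0 = 0.
Proof.
suff : cos_prim n 0 = 0 /\ cos_prim n.+1 0 = 0 by case.
elim: n => [|n [IH0 IH1]]; first by rewrite /= sin0.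
by split => //=; rewrite IH0 sin0 !mulr0 addr0 mul0r.
Qed.

Lemma cos_primSS_pihalf n :
  cos_prim n.+2 (pi / 2) = n.+1%:R / n.+2%:R * cos_prim n (pi / 2).
Proof. by rewrite /= cos_pihalf exprS !mul0r add0r mulrAC. Qed.

(** The difference of the two primitives vanishes at 0 and has derivative
    [cos ^+ n * (1 - cos)], which is nonnegative on [[0, pi / 2]]. *)
Lemma cos_prim_pihalf_nincr n :
  cos_prim n.+1 (pi / 2) <= cos_prim n (pi / 2).
Proof.
have pi0 : 0 <= pi / 2 :> R by rewrite divr_ge0 ?pi_ge0.
have D (x : R) :
    is_derive x 1 (cos_prim n - cos_prim n.+1) (cos x ^+ n - cos x ^+ n.+1).
  exact: is_deriveB (is_derive_cos_prim _ _) (is_derive_cos_prim _ _).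
have : (cos_prim n - cos_prim n.+1) 0 <= (cos_prim n - cos_prim n.+1) (pi / 2).
  apply: (@ger0_derive1_ndecr _ _ 0 (pi / 2)) => // [x|].
  - rewrite in_itv/= => /andP[x0 x1].
    rewrite derive1E (@derive_val _ _ _ _ _ _ _ (D x)) exprS.
    rewrite -{1}[cos x ^+ n]mul1r -mulrBl.
    rewrite mulr_ge0 ?subr_ge0 ?cos_le1// exprn_ge0// cos_ge0_pihalf//.
    by rewrite (ltW x1) andbT; lra.
  - by apply: derivable_within_continuous => x _; have [] := D x.
rewrite -[X in X <= _]/(cos_prim n 0 - cos_prim n.+1 0) !cos_prim_at0 subrr.
by rewrite -[X in _ <= X]/(cos_prim n _ - cos_prim n.+1 _) subr_ge0.
Qed.

(** At [pi / 2] only the last term of the reduction formula survives, which is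
    the recurrence [centralS] for even exponents and its inverse for odd ones. *)
Lemma cos_prim_even n : cos_prim (2 * n) (pi / 2) = central n * (pi / 2).
Proof.
elim: n => [|n IH]; first by rewrite muln0 central0 mul1r.
have -> : (2 * n.+1 = (2 * n).+2)%N by lia.
rewrite cos_primSS_pihalf IH centralS [(2 * n + 1)%N]addn1.
have -> : (2 * n).+2%:R = 2 * n.+1%:R :> R by rewrite -natrM; congr (_%:R); lia.
ring.
Qed.

Lemma cos_prim_odd n : (2 * n + 1)%:R * central n * cos_prim (2 * n).+1 (pi / 2) = 1.
Proof.
elim: n => [|n IH]; first by rewrite muln0 central0 !mul1r /= sin_pihalf.
have -> : (2 * n.+1 = (2 * n).+2)%N by lia.
rewrite cos_primSS_pihalf centralS -[RHS]IH.
have -> : (2 * n).+2%:R = 2 * n.+1%:R :> R by rewrite -natrM; congr (_%:R); lia.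
rewrite addn1.
have a0 : n.+1%:R != 0 :> R by rewrite pnatr_eq0.
have b0 : (2 * n).+3%:R != 0 :> R by rewrite pnatr_eq0.
rewrite addn1; move: (2 * n).+3%:R n.+1%:R a0 b0 => b a a0 b0; field.
by rewrite a0 b0.
Qed.

(** Monotonicity from exponent [2 * n - 1] to [2 * n]. *)
Lemma wallis_upper n : (0 < n)%N -> central n ^+ 2 * (pi * n%:R) <= 1 :> R.
Proof.
case: n => // n _.
have := cos_prim_pihalf_nincr (2 * n).+1.
have -> : ((2 * n).+2 = 2 * n.+1)%N by lia.
rewrite cos_prim_even => h.
have c0 : 0 < (2 * n + 1)%:R * central n :> R.
  by rewrite mulr_gt0 ?central_gt0// ltr0n addn1.
move: h; rewrite -(ler_pM2l c0) cos_prim_odd; apply: le_trans.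
rewrite le_eqVlt; apply/orP; left; apply/eqP; rewrite expr2 {1}centralS.
by field; rewrite ?natr1 ?nat1r pnatr_eq0.
Qed.

(** Monotonicity from exponent [2 * n] to [2 * n + 1]. *)
Lemma wallis_lower n : 1 <= central n ^+ 2 * (pi * (n%:R + 2^-1)) :> R.
Proof.
have := cos_prim_pihalf_nincr (2 * n).
rewrite cos_prim_even => h.
have c0 : 0 < (2 * n + 1)%:R * central n :> R.
  by rewrite mulr_gt0 ?central_gt0// ltr0n addn1.
move: h; rewrite -(ler_pM2l c0) cos_prim_odd => /le_trans; apply.
rewrite le_eqVlt; apply/orP; left; apply/eqP; rewrite natrD natrM expr2.
by field.
Qed.

Lemma ler_of_harmonic (N0 : nat) (x y : R) :
  (forall N, (N0 <= N)%N -> (0 < N)%N -> x <= y + N%:R^-1) -> x <= y.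
Proof.
move=> h; apply/ler_addgt0Pr => e e0.
pose N := (maxn N0 (Num.truncn e^-1).+1).
have N0' : (0 < N)%N by rewrite /N; lia.
apply: le_trans (h N _ N0') _; first by rewrite /N; lia.
rewrite lerD2l invf_ple ?posrE ?ltr0n//.
apply: le_trans (ltW (truncnS_gt _)) _.
by rewrite ler_nat leq_maxr.
Qed.

(** The left-hand side increases with [n], and Wallis's upper bound makes its
    limit at most 1. *)
Lemma central_upper n : central n ^+ 2 * (pi * (n%:R + 4^-1)) <= 1 :> R.
Proof.
have pi0 := pi_gt0 R.
have mono d : central n ^+ 2 * (pi * (n%:R + 4^-1)) <=
    central (n + d) ^+ 2 * (pi * ((n + d)%:R + 4^-1)) :> R.
  elim: d => [|d IH]; first by rewrite addn0.
  apply: le_trans IH _; rewrite addnS; move: (n + d)%N => k.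
  rewrite centralS natrD natrM -[k.+1%:R]natr1.
  have k0 : 0 <= k%:R :> R by [].
  set c := central k; move: k%:R k0 => x x0.
  rewrite -subr_ge0.
  have -> : (c * (2 * x + 1) / (2 * (x + 1))) ^+ 2 * (pi * (x + 1 + 4^-1)) -
     c ^+ 2 * (pi * (x + 4^-1)) = c ^+ 2 * pi / (16 * (x + 1) ^+ 2).
    by field; rewrite gt_eqF//; lra.
  by apply: divr_ge0; apply: mulr_ge0; rewrite ?sqr_ge0 ?(ltW pi0).
apply: (@ler_of_harmonic n) => N nN N0.
apply: le_trans (mono (N - n)%N) _; rewrite subnKC// => {mono}.
have N0' : 0 < N%:R :> R by rewrite ltr0n.
have u := wallis_upper N N0.
have -> : central N ^+ 2 * (pi * (N%:R + 4^-1)) =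
  (central N ^+ 2 * (pi * N%:R)) * (1 + 4^-1 * N%:R^-1) :> R.
  by field; rewrite gt_eqF.
have i0 : 0 < N%:R^-1 :> R by rewrite invr_gt0.
apply: (le_trans (y := 1 * (1 + 4^-1 * N%:R^-1))); last lra.
by rewrite ler_wpM2r//; lra.
Qed.

(** With the correction [(32 * n)^-1] the sequence decreases instead, and
    Wallis's lower bound makes its limit at least 1. *)
Lemma central_lower n : (0 < n)%N ->
  1 <= central n ^+ 2 * (pi * (n%:R + 4^-1 + (32 * n%:R)^-1)) :> R.
Proof.
move=> n0; have pi0 := pi_gt0 R.
have mono d :
    central (n + d) ^+ 2 * (pi * ((n + d)%:R + 4^-1 + (32 * (n + d)%:R)^-1)) <=
    central n ^+ 2 * (pi * (n%:R + 4^-1 + (32 * n%:R)^-1)) :> R.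
  elim: d => [|d IH]; first by rewrite addn0.
  apply: le_trans IH; rewrite addnS.
  have : (0 < n + d)%N by rewrite addn_gt0 n0.
  move: (n + d)%N => k k0.
  rewrite centralS natrD natrM -[k.+1%:R]natr1.
  have {}k0 : 0 < k%:R :> R by rewrite ltr0n.
  set c := central k; move: k%:R k0 => x x0.
  rewrite -subr_ge0.
  have -> : c ^+ 2 * (pi * (x + 4^-1 + (32 * x)^-1)) -
     (c * (2 * x + 1) / (2 * (x + 1))) ^+ 2 *
       (pi * (x + 1 + 4^-1 + (32 * (x + 1))^-1)) =
     c ^+ 2 * pi * (3 * x + 4) / (128 * x * (x + 1) ^+ 3).
    by field; rewrite !gt_eqF//; lra.
  apply: divr_ge0; apply: mulr_ge0; rewrite ?exprn_ge0 ?mulr_ge0 ?sqr_ge0//;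
    by rewrite ?(ltW pi0)//; lra.
apply: (@ler_of_harmonic n) => N nN N0; rewrite -lerBlDr.
apply: le_trans (mono (N - n)%N); rewrite subnKC// => {mono}.
have N0' : 0 < N%:R :> R by rewrite ltr0n.
have i0 : 0 < N%:R^-1 :> R by rewrite invr_gt0.
have u : central N ^+ 2 * pi <= N%:R^-1 :> R.
  by rewrite -[leRHS]mul1r ler_pdivlMr// -mulrA wallis_upper.
have l := wallis_lower N.
have p0 : 0 <= central N ^+ 2 * pi / (32 * N%:R) :> R.
  by apply: divr_ge0; apply: mulr_ge0; rewrite ?sqr_ge0 ?(ltW pi0).
have -> : central N ^+ 2 * (pi * (N%:R + 4^-1 + (32 * N%:R)^-1)) =
  central N ^+ 2 * (pi * (N%:R + 2^-1)) - central N ^+ 2 * pi / 4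
  + central N ^+ 2 * pi / (32 * N%:R) :> R.
  by field; rewrite gt_eqF.
by move: u l p0; set a := _ * pi; set b := _ / (32 * _); set c := _ * (pi * _); lra.
Qed.

(** A second-order expansion of [t = (1 + y / 4 + O(y ^ 2)) ^ (- 1 / 2)]; with
    [y = k^-1] and [t = central k * sqrt (pi * k)] the hypotheses are
    [central_upper] and [central_lower]. *)
Lemma sqrt_bracket (t y : R) : 0 < t -> 0 < y <= 1 ->
  t ^+ 2 * (1 + y / 4) <= 1 -> 1 <= t ^+ 2 * (1 + y / 4 + y ^+ 2 / 32) ->
  `|t - 1 + y / 8| <= y ^+ 2.
Proof.
move=> t0 /andP[y0 y1] up lo.
have y2 : 0 < y ^+ 2 by rewrite exprn_gt0.
have y21 : y ^+ 2 <= 1 by rewrite exprn_ile1// ltW.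
have tu : t ^+ 2 <= 1 - y / 4 + y ^+ 2 / 16.
  rewrite -(@ler_pM2r _ (1 + y / 4)); last lra.
  apply: (le_trans up); rewrite -subr_ge0.
  have -> : (1 - y / 4 + y ^+ 2 / 16) * (1 + y / 4) - 1 = y ^+ 3 / 64 by field.
  by rewrite divr_ge0// exprn_ge0// ltW.
have tl : 1 - (y / 4 + y ^+ 2 / 32) <= t ^+ 2.
  set q := y / 4 + _; have q0 : 0 < q by rewrite /q; lra.
  rewrite -(@ler_pM2r _ (1 + q)); last lra.
  apply: (le_trans (y := 1)); last by rewrite /q addrA.
  have -> : (1 - q) * (1 + q) = 1 - q ^+ 2 by ring.
  by rewrite gerBl sqr_ge0.
rewrite ler_norml; apply/andP; split.
- rewrite -subr_ge0 opprK.
  have [neg|pos] := leP (1 - y / 8 - y ^+ 2) 0; first by lra.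
  suff : 1 - y / 8 - y ^+ 2 <= t by lra.
  rewrite -(@ler_pXn2r _ 2)// ?nnegrE ?(ltW t0) ?(ltW pos)//.
  apply: le_trans tl; rewrite -subr_ge0.
  have -> : 1 - (y / 4 + y ^+ 2 / 32) - (1 - y / 8 - y ^+ 2) ^+ 2 =
    y ^+ 2 * (125 / 64 - y / 4 - y ^+ 2) by field.
  by rewrite mulr_ge0 ?(ltW y2)//; lra.
- suff : t <= 1 - y / 8 + y ^+ 2 by lra.
  rewrite -(@ler_pXn2r _ 2)// ?nnegrE ?(ltW t0)//; last by lra.
  apply: (le_trans tu); rewrite -subr_ge0.
  have -> : (1 - y / 8 + y ^+ 2) ^+ 2 - (1 - y / 4 + y ^+ 2 / 16) =
    y ^+ 2 * (125 / 64 - y / 4 + y ^+ 2) by field.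
  by rewrite mulr_ge0 ?(ltW y2)//; lra.
Qed.

Lemma central_expansion k : (0 < k)%N ->
  `|k%:R * central k - Num.sqrt (k%:R / pi) + (8 * Num.sqrt (pi * k%:R))^-1|
    <= (k%:R * Num.sqrt k%:R)^-1 :> R.
Proof.
move=> k0; have pi0 := pi_gt0 R.
have k0' : 0 < k%:R :> R by rewrite ltr0n.
have k1 : 1 <= k%:R :> R by rewrite ler1n.
have up := central_upper k; have lo := central_lower k k0.
have c0 : 0 < central k :> R := central_gt0 k.
rewrite !sqrtrM ?(ltW k0') ?(ltW pi0)// sqrtrV ?(ltW pi0)//.
have r2 : Num.sqrt k%:R ^+ 2 = k%:R :> R by rewrite sqr_sqrtr// ltW.
have p2 : Num.sqrt pi ^+ 2 = pi :> R by rewrite sqr_sqrtr// ltW.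
have r1 : 1 <= Num.sqrt k%:R :> R by rewrite -[leLHS]sqrtr1 ler_wsqrtr.
have p1 : 1 <= Num.sqrt pi :> R.
  by rewrite -[leLHS]sqrtr1 ler_wsqrtr// (le_trans _ (pi_ge2 R))// ler1n.
move: (central k) c0 (Num.sqrt k%:R) r1 r2 (Num.sqrt pi) p1 p2 up lo.
move=> c c0 r r1 r2 p p1 p2; rewrite -p2 -r2 => up lo.
have r0 : 0 < r by lra.
have p0 : 0 < p by lra.
have rn : r != 0 by rewrite gt_eqF.
have pn : p != 0 by rewrite gt_eqF.
have -> : r ^+ 2 * c - r / p + (8 * (p * r))^-1 =
    r / p * (c * p * r - 1 + r ^- 2 / 8).
  by field; rewrite rn pn.
have y0 : 0 < r ^- 2 by rewrite invr_gt0 exprn_gt0.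
have B : `|c * p * r - 1 + r ^- 2 / 8| <= (r ^- 2) ^+ 2.
  apply: sqrt_bracket; first by rewrite !mulr_gt0.
  - by rewrite y0 invf_le1 ?exprn_gt0// exprn_ege1.
  - by apply: le_trans up; rewrite le_eqVlt; apply/orP; left; apply/eqP; field.
  - by apply: (le_trans lo); rewrite le_eqVlt; apply/orP; left; apply/eqP; field.
rewrite normrM ger0_norm; last by rewrite divr_ge0// ltW.
have -> : (r ^+ 2 * r)^-1 = r * (r ^- 2) ^+ 2 by field.
apply: ler_pM => //; first by rewrite divr_ge0// ltW.
by rewrite ler_pdivrMr// ler_peMr// ltW.
Qed.

End Wallis.

(** * The relative order of independent uniform weights *)

Section FiniteValued.
Context {d : measure_display} {T : measurableType d} {R : realType}.
Context (P : probability T R) {C : finType} (Z : T -> C).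
Context (mZ : forall c, measurable (Z @^-1` [set c])).

Lemma integral_finite_valued (g : C -> R) : (forall c, 0 <= g c) ->
  (\int[P]_omega (g (Z omega))%:E)%E =
  (\sum_c g c * fine (P (Z @^-1` [set c])))%:E.
Proof.
move=> g0; rewrite -sumEFin.
transitivity (\int[P]_omega (\sum_c (g c)%:E * (\1_(Z @^-1` [set c]) omega)%:E))%E.
  apply: eq_integral => x _; rewrite (bigD1 (Z x))//= big1 => [|c /eqP cZ].
    by rewrite indicE mem_set// mule1 adde0.
  by rewrite indicE memNset ?mule0//= => /esym.
have mI c : measurable_fun [set: T] (EFin \o (\1_(Z @^-1` [set c]) : T -> R)).
  by apply/measurable_EFinP; exact: measurable_indic.
rewrite ge0_integral_sum//=.
- apply: eq_bigr => c _; rewrite ge0_integralZl ?lee_fin//; last exact: mI.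
  by rewrite integral_indic//= setIT EFinM fineK// fin_num_measure.
- by move=> c; apply: measurable_funeM; exact: mI.
- by move=> c x _; rewrite mule_ge0 ?lee_fin// indicE.
Qed.

Lemma measurable_finite_valued (phi : pred C) :
  measurable [set omega | phi (Z omega)].
Proof.
have -> : [set x | phi (Z x)] = \bigcup_(c in [set` phi]) (Z @^-1` [set c]).
  by apply/seteqP; split => [x px|x [c /= pc ->//]]; exists (Z x).
by apply: fin_bigcup_measurable => //; exact: finite_finset.
Qed.

Lemma prob_finite_valued (phi : pred C) :
  P [set omega | phi (Z omega)] =
  (\sum_c (phi c)%:R * fine (P (Z @^-1` [set c])))%:E.
Proof.
rewrite -(@integral_finite_valued (fun c => (phi c)%:R))//.
transitivity (\int[P]_x (\1_[set x | phi (Z x)] x)%:E)%E; last first.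
  apply: eq_integral => x _; rewrite indicE (_ : (x \in _) = phi (Z x))//.
  by apply/idP/idP; rewrite inE.
by rewrite integral_indic ?setIT//; exact: measurable_finite_valued.
Qed.

End FiniteValued.

Section Pattern.
Context {d : measure_display} {T : measurableType d} {R : realType}.
Context {P : probability T R} {I : finType} (w : I -> {RV P >-> R}).

(** The order of the weights, encoded as the finite set of pairs in increasing
    order: every event of interest depends on it alone. *)
Definition comparisons (omega : T) : {set I * I} :=
  [set p | w p.1 omega < w p.2 omega]%SET.

Lemma sigma_of_measurable (A : set T) : sigma_of w A -> measurable A.
Proof.
apply: smallest_sub; first exact: sigma_algebra_measurable.
by move=> _ [i [B [mB ->]]]; rewrite -[X in measurable X]setTI; exact: measurable_funP.
Qed.

(** Needed to apply the independence of the vertex, which is stated for events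
    in the sigma-algebra generated by the weights. *)
Lemma sigma_of_comparisons c : sigma_of w (comparisons @^-1` [set c]).
Proof.
pose G : set (set T) := [set A | exists i (B : set R), measurable B /\ A = w i @^-1` B].
have mw i : measurable_fun setT (w i : g_sigma_algebraType G -> R).
  by move=> _ B mB; rewrite setTI; apply: sub_sigma_algebra; exists i, B.
suff : measurable (comparisons @^-1` [set c] : set (g_sigma_algebraType G)) by [].
have -> : comparisons @^-1` [set c] =
   \bigcap_(p in [set: I * I]) ((fun x => w p.1 x < w p.2 x) @^-1` [set p \in c]).
  apply/seteqP; split => [x /= <- p _ /=|x h /=]; first by rewrite inE.
  by apply/setP => p; rewrite inE; exact: h.
apply: fin_bigcap_measurable => //.
move=> p _; have := @measurable_fun_ltr _ _ _ setT _ _ (mw p.1) (mw p.2).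
by move=> /(_ measurableT [set p \in c]); rewrite setTI; apply.
Qed.

End Pattern.

Section Uniform.
Context {R : realType}.

Lemma uniform_prob_itv (a b : R) : 0 <= a -> a <= b -> b <= 1 ->
  uniform_prob (@ltr01 R) `[a, b[%classic = (b - a)%:E.
Proof.
move=> a0 ab b1; rewrite /uniform_prob.
rewrite (eq_integral (fun=> 1%E)); last first.
  move=> x; rewrite inE/= in_itv/= => /andP[ax xb]; rewrite /uniform_pdf.
  by rewrite (le_trans a0 ax) (le_trans (ltW xb) b1) subr0 invr1.
rewrite integral_cst//= lebesgue_measure_itv/= lte_fin mul1e.
have [_|] := ltP a b; first by rewrite EFinB.
by move=> ba; rewrite (@le_anti _ _ a b) ?ab// subrr.
Qed.

Lemma ler_expS_succ (x : R) (s : nat) : 0 <= x ->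
  (x + 1) ^+ s.+1 <= x ^+ s.+1 + s.+1%:R * (x + 1) ^+ s.
Proof.
move=> x0; elim: s => [|s IH]; first by rewrite !expr1 expr0 mulr1.
rewrite exprS; apply: (le_trans (ler_wpM2l _ IH)); first by rewrite addr_ge0.
have -> : (x + 1) * (x ^+ s.+1 + s.+1%:R * (x + 1) ^+ s) =
   x ^+ s.+2 + s.+1%:R * (x + 1) ^+ s.+1 + x ^+ s.+1 by rewrite !exprS; ring.
rewrite -[s.+2%:R]natr1 [leRHS]addrC mulrDl mul1r.
have : x ^+ s.+1 <= (x + 1) ^+ s.+1 by rewrite lerXn2r// ?nnegrE ?addr_ge0// lerDl.
lra.
Qed.

(** The comparison of [x ^ s] with its right Riemann sum, in the division-free
    form that goes through by induction on [N]. *)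
Lemma sum_pow_ge (N s : nat) :
  N%:R ^+ s.+1 <= s.+1%:R * (\sum_(i < N) i%:R ^+ s + N%:R ^+ s) :> R.
Proof.
elim: N => [|N IH]; first by rewrite big_ord0 add0r exprS mul0r mulr_ge0 ?exprn_ge0.
rewrite big_ord_recr/= mulrDr -[N.+1%:R]natr1.
apply: le_trans (ler_expS_succ N%:R s _) _ => //.
by rewrite lerD2r.
Qed.

Lemma riemann_pow_ge (N s : nat) : (0 < N)%N ->
  s.+1%:R^-1 <= \sum_(i < N) N%:R^-1 * (i%:R / N%:R) ^+ s + N%:R^-1 :> R.
Proof.
move=> N0; have N0' : 0 < N%:R ^+ s.+1 :> R by rewrite exprn_gt0 ?ltr0n.
have Nn : N%:R != 0 :> R by rewrite pnatr_eq0 -lt0n.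
have s0 : 0 < s.+1%:R :> R by rewrite ltr0n.
rewrite -(ler_pM2l s0) mulfV ?gt_eqF// -(ler_pM2l N0') mulr1.
apply: (le_trans (sum_pow_ge N s)).
rewrite le_eqVlt; apply/orP; left; apply/eqP.
rewrite [RHS]mulrCA; congr (_ * _); rewrite mulrDr mulr_sumr; congr (_ + _).
  apply: eq_bigr => i _; rewrite expr_div_n exprS; field.
  by rewrite Nn expf_neq0.
by rewrite exprS; field.
Qed.

End Uniform.

Section IID.
Context {d : measure_display} {T : measurableType d} {R : realType}.
Context {P : probability T R} {I : finType} (w : I -> {RV P >-> R}).

Definition comparison_law (c : {set I * I}) : R :=
  fine (P (comparisons w @^-1` [set c])).

Definition comparison_mean (g : {set I * I} -> R) : R :=
  \sum_c g c * comparison_law c.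

Lemma measurable_comparisons c : measurable (comparisons w @^-1` [set c]).
Proof. exact: sigma_of_measurable (sigma_of_comparisons w c). Qed.

Lemma comparison_law_ge0 c : 0 <= comparison_law c.
Proof. exact: fine_ge0. Qed.

Lemma comparison_mean_prob (phi : pred {set I * I}) :
  P [set omega | phi (comparisons w omega)] =
  (comparison_mean (fun c => (phi c)%:R))%:E.
Proof. exact: (prob_finite_valued P _ measurable_comparisons). Qed.

Lemma measurable_comparison_event (phi : pred {set I * I}) :
  measurable [set omega | phi (comparisons w omega)].
Proof. exact: (measurable_finite_valued _ measurable_comparisons). Qed.

(** A pattern that no outcome realizes has mass 0, so functions of patterns may
    be compared on realized patterns only. This matters because an arbitrary
    set of pairs need not be an order. *)
Lemma comparison_law_support (g h : {set I * I} -> R) c :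
  (forall omega, g (comparisons w omega) = h (comparisons w omega)) ->
  g c * comparison_law c = h c * comparison_law c.
Proof.
move=> gh; have [E|/set0P[omega <-]] := eqVneq (comparisons w @^-1` [set c]) set0.
  by rewrite /comparison_law E measure0 !mulr0.
by rewrite gh.
Qed.

Lemma comparison_mean_eq (g h : {set I * I} -> R) :
  (forall omega, g (comparisons w omega) = h (comparisons w omega)) ->
  comparison_mean g = comparison_mean h.
Proof. by move=> gh; apply: eq_bigr => c _; exact: comparison_law_support. Qed.

Lemma comparison_mean_sum (J : finType) (Q : pred J) (g : J -> {set I * I} -> R) :
  comparison_mean (fun c => \sum_(j | Q j) g j c) =
  \sum_(j | Q j) comparison_mean (g j).
Proof.
by rewrite exchange_big; apply: eq_bigr => c _; rewrite mulr_suml.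
Qed.

Lemma comparison_mean_cst (a : R) : comparison_mean (fun=> a) = a.
Proof.
have := comparison_mean_prob predT.
have -> : [set omega | predT (comparisons w omega)] = setT by apply/seteqP; split.
rewrite probability_setT => -[h]; rewrite /comparison_mean -mulr_sumr.
rewrite /comparison_mean -mulr_sumr mul1r in h.
by rewrite -h mulr1.
Qed.

Lemma comparison_mean_le1 (g : {set I * I} -> R) :
  (forall omega, g (comparisons w omega) <= 1) -> comparison_mean g <= 1.
Proof.
(* The bound is known on realized patterns only; truncating extends it. *)
move=> g1; have -> : comparison_mean g = comparison_mean (fun c => Num.min (g c) 1).
  by apply: comparison_mean_eq => omega; apply/esym/min_idPl.
rewrite -[leRHS](comparison_mean_cst 1); apply: ler_sum => c _.
by rewrite ler_wpM2r ?comparison_law_ge0// ge_min lexx orbT.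
Qed.

Context (hu : forall i, uniform01 (w i)).
Context (hi : mutually_independent w).

Lemma prob_weight_itv i (a b : R) : 0 <= a -> a <= b -> b <= 1 ->
  P (w i @^-1` `[a, b[) = (b - a)%:E.
Proof. by move=> *; rewrite -uniform_prob_itv// -(hu i). Qed.

Let heaviest (S : {set I}) (e : I) (c : {set I * I}) : bool :=
  [forall f in S, (f, e) \in c].

(** If [w e] lies in the i-th cell of width [1 / N] and all other weights lie
    below that cell, then [e] is the heaviest. These rectangles are disjoint and
    independence gives their probabilities, whose sum is a Riemann sum. *)
Lemma max_prob_ge (S : {set I}) e : e \notin S ->
  #|S|.+1%:R^-1 <= comparison_mean (fun c => (heaviest S e c)%:R).
Proof.
move=> eS; apply: (@ler_of_harmonic _ 1) => N N1 _.
have N0 : 0 < N%:R :> R by rewrite ltr0n.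
apply: le_trans (riemann_pow_ge N #|S| N1) _; rewrite lerD2r.
pose B (i : nat) g := if g == e then `[i%:R / N%:R, i.+1%:R / N%:R[%classic
  else `[0, i%:R / N%:R[%classic : set R.
pose E (i : 'I_N) := \bigcap_(g in [set` e |: S]%SET) (w g @^-1` B i g).
have mB i g : measurable (B i g) by rewrite /B; case: ifP.
have mE i : measurable (E i).
  apply: fin_bigcap_measurable; first exact: finite_finset.
  by move=> g _; rewrite -[X in measurable X]setTI; exact: measurable_funP.
have PE i : P (E i) = (N%:R^-1 * (i%:R / N%:R) ^+ #|S|)%:E.
  rewrite /E hi// big_setU1//=.
  have i0 : 0 <= i%:R / N%:R :> R by rewrite divr_ge0.
  have iN : i.+1%:R / N%:R <= 1 :> R by rewrite ler_pdivrMr// mul1r ler_nat.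
  have ii : i%:R / N%:R <= i.+1%:R / N%:R :> R by rewrite ler_pM2r ?invr_gt0// ler_nat.
  rewrite {1}/B eqxx prob_weight_itv// -mulrBl -natr1 addrC addKr mul1r EFinM.
  congr (_ * _)%E; rewrite -prodr_const.
  rewrite -prodEFin; apply: eq_bigr => g gS; rewrite /B ifN ?prob_weight_itv ?subr0//.
    exact: le_trans iN.
  by apply: contraNneq eS => <-.
rewrite -lee_fin -sumEFin -comparison_mean_prob.
under eq_bigr do rewrite -PE.
rewrite -measure_bigsetU_ord//; last first.
  apply/trivIsetP => i j _ _ ij; rewrite -subset0 => omega [Ei Ej].
  have {}Ei : B i e (w e omega) by apply: Ei; rewrite /= setU11.
  have {}Ej : B j e (w e omega) by apply: Ej; rewrite /= setU11.
  rewrite /B eqxx/= in_itv/= in Ei; rewrite /B eqxx/= in_itv/= in Ej.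
  case/andP: Ei => i1 i2; case/andP: Ej => j1 j2.
  have := le_lt_trans j1 i2; have := le_lt_trans i1 j2.
  rewrite !ltr_pM2r ?invr_gt0// !ltr_nat !ltnS => ij1 ij2.
  have eij : i = j by apply: val_inj; apply/eqP; rewrite eqn_leq ij1.
  by rewrite eij eqxx in ij.
apply: le_measure; rewrite ?inE.
- exact: bigsetU_measurable.
- exact: measurable_comparison_event.
- apply: (big_ind (fun X => X `<=` _)) => // [X Y XS YS|i _ omega Ei /=].
    by rewrite subUset.
  apply/forall_inP => f fS; rewrite inE /=.
  have {}fE : B i f (w f omega) by apply: Ei; rewrite /= setU1r.
  have {}Ei : B i e (w e omega) by apply: Ei; rewrite /= setU11.
  rewrite /B eqxx/= in_itv/= in Ei; case/andP: Ei => i1 _.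
  have fe : f != e by apply: contraNneq eS => <-.
  rewrite /B (negbTE fe)/= in_itv/= in fE; case/andP: fE => _ i2.
  exact: lt_le_trans i1.
Qed.

(** Each member of [e |: S] is the heaviest with probability at least
    [1 / (#|S| + 1)] and at most one of them is, so all bounds are equalities. *)
Lemma max_prob (S : {set I}) e : e \notin S ->
  comparison_mean (fun c => (heaviest S e c)%:R) = #|S|.+1%:R^-1.
Proof.
move=> eS; pose U := (e |: S)%SET.
have cU : #|U| = #|S|.+1 by rewrite cardsU1 eS.
pose gap f := comparison_mean (fun c => (heaviest (U :\ f) f c)%:R) - #|S|.+1%:R^-1.
have gap0 f : f \in U -> 0 <= gap f.
  move=> fU; rewrite subr_ge0; apply: le_trans (max_prob_ge (U :\ f) f _).
    by rewrite -cU (cardsD1 f U) fU.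
  by rewrite !inE eqxx.
have sum_gap : \sum_(f in U) gap f <= 0.
  rewrite sumrB sumr_const -[X in _ - X]mulr_natr cU mulVf ?pnatr_eq0// subr_le0.
  rewrite -comparison_mean_sum; apply: comparison_mean_le1 => omega.
  (* Two heaviest elements f and g would satisfy w f < w g < w f. *)
  case: (pickP [pred f in U | heaviest (U :\ f) f (comparisons w omega)]) => [f|none].
    move=> /andP[/= fU hf]; rewrite (bigD1 f)//= hf big1 ?addr0// => g /andP[gU gf].
    apply/eqP; rewrite pnatr_eq0 eqb0; apply/negP => /forall_inP hg.
    have := hg f; rewrite in_setD1 eq_sym gf fU => /(_ isT) fg.
    move/forall_inP: hf => /(_ g); rewrite in_setD1 gf gU => /(_ isT) gf'.
    rewrite inE/= in fg; rewrite inE/= in gf'; have := lt_trans fg gf'.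
    by rewrite ltxx.
  by rewrite big1 ?ler01// => f fU; have := none f; rewrite /= [f \in U]fU/= => ->.
have : \sum_(f in U) gap f == 0 by rewrite eq_le sum_gap sumr_ge0.
rewrite psumr_eq0// => /allP/(_ e (mem_index_enum _)).
rewrite setU11/= subr_eq0 => /eqP <-.
by rewrite setU1K.
Qed.

(** Induction on [#|U|]: removing [f] from [U] merges the event with the one
    where [f] has moved to [S], and [1 - 'X] accounts for the difference. *)
Lemma order_pattern_prob (S U : {set I}) e : e \notin S -> e \notin U ->
  [disjoint S & U]%B ->
  comparison_mean (fun c => ([forall f in S, (f, e) \in c] &&
     [forall f in U, (f, e) \notin c])%:R) =
  int01 ('X^#|S| * (1 - 'X) ^+ #|U|).
Proof.
move: {2}#|U| (erefl #|U|) => n; elim: n S U => [|n IH] S U.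
  move/eqP; rewrite cards_eq0 => /eqP -> eS _ _.
  rewrite cards0 expr0 mulr1 int01_Xn -(max_prob S e eS); apply: eq_bigr => c _.
  congr (_%:R * _); congr nat_of_bool; rewrite /heaviest -[RHS]andbT; congr (_ && _).
  by apply/forall_inP => f; rewrite inE.
move=> cU eS eU SU.
have /card_gt0P[f fU] : (0 < #|U|)%N by rewrite cU.
have fS : f \notin S by rewrite (disjointFl SU).
have cU' : #|U :\ f| = n by move: cU; rewrite (cardsD1 f U) fU => -[].
have eU' : e \notin U :\ f by rewrite !inE (negbTE eU) andbF.
have ef : e != f by apply: contraNneq eU => ->.
have h1 := IH S (U :\ f) cU' eS eU'.
have h2 := IH (f |: S)%SET (U :\ f) cU'.
rewrite in_setU1 negb_or ef eS /= in h2.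
have SU' : [disjoint S & U :\ f]%B.
  rewrite disjoint_subset; apply/fintype.subsetP => g gS.
  by rewrite !inE (disjointFr SU gS) andbF.
have fSU' : [disjoint f |: S & U :\ f]%B.
  rewrite disjoint_subset; apply/fintype.subsetP => g.
  rewrite !inE => /predU1P[->|gS]; first by rewrite eqxx.
  by rewrite (disjointFr SU gS) andbF.
have {}h1 := h1 SU'; have {}h2 := h2 isT eU' fSU'.
have -> : int01 ('X^#|S| * (1 - 'X) ^+ #|U|) =
    int01 ('X^#|S| * (1 - 'X) ^+ #|U :\ f|) -
    int01 ('X^#|f |: S|%SET * (1 - 'X) ^+ #|U :\ f|) :> R.
  rewrite -linearB; congr (int01 _).
  rewrite cardsU1 fS cU cU' add1n !exprS; ring.
rewrite -h1 -h2 -sumrB; apply: eq_bigr => c _; rewrite -mulrBl; congr (_ * _).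
have -> : [forall g in U, (g, e) \notin c] =
    ((f, e) \notin c) && [forall g in U :\ f, (g, e) \notin c].
  apply/forall_inP/andP => [h|[hf /forall_inP h] g gU].
    by split; [exact: h|apply/forall_inP => g; rewrite !inE => /andP[_]; exact: h].
  by have [->//|gf] := eqVneq g f; apply: h; rewrite !inE gf.
have -> : [forall g in f |: S, (g, e) \in c]%SET =
    ((f, e) \in c) && [forall g in S, (g, e) \in c].
  apply/forall_inP/andP => [h|[hf /forall_inP h] g].
    split; first by apply: h; rewrite setU11.
    by apply/forall_inP => g gS; apply: h; rewrite setU1r.
  by rewrite !inE => /predU1P[->//|]; exact: h.
by case: (_ \in c); case: [forall _ in S, _]; case: [forall _ in _, _];
   rewrite ?subrr ?subr0.
Qed.

End IID.

(** The binomial coefficient counts the subsets of each size. *)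
Lemma bernstein_sum_subsets (F : numFieldType) (I : finType) (A : {set I}) k :
  \sum_(S : {set I} | (S \subset A) && (#|S| < k)%N)
     ('X^#|S| * (1 - 'X) ^+ (#|A| - #|S|)) = bernstein_sum #|A| k :> {poly F}.
Proof.
rewrite /bernstein_sum.
transitivity (\sum_(a < k) \sum_(S : {set I} | (S \subset A) && (#|S| == a))
   ('X^#|S| * (1 - 'X) ^+ (#|A| - #|S|)) : {poly F}).
  rewrite (exchange_big_dep (fun S : {set I} => S \subset A))/=; last first.
    by move=> a S _ /andP[].
  rewrite big_mkcondr; apply: eq_bigr => S SA.
  case: ifPn => [Sk|/negbTE Sk].
    by rewrite (big_pred1 (Ordinal Sk))// => a /=; rewrite SA eq_sym.
  by rewrite big_pred0// => a; rewrite SA/=; apply: contraFF Sk => /eqP ->.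
apply: eq_bigr => a _; rewrite /bernstein -cards_draws.
rewrite (eq_bigr (fun=> 'X^a * (1 - 'X) ^+ (#|A| - a))); last first.
  by move=> S /andP[_ /eqP ->].
by rewrite sumr_const scaler_nat; congr (_ *+ _); apply: eq_card => S; rewrite !inE.
Qed.

Section IID2.
Context {d : measure_display} {T : measurableType d} {R : realType}.
Context {P : probability T R} {I : finType} (w : I -> {RV P >-> R}).
Context (hu : forall i, uniform01 (w i)).
Context (hi : mutually_independent w).

Definition lighter (A : {set I}) (e : I) (c : {set I * I}) : {set I} :=
  [set f in A | (f, e) \in c]%SET.

Lemma lighter_eq (A S : {set I}) e c : S \subset A ->
  (lighter A e c == S) =
  [forall f in S, (f, e) \in c] && [forall f in A :\: S, (f, e) \notin c].
Proof.
move=> /fintype.subsetP SA; apply/eqP/andP => [<-|[/forall_inP h1 /forall_inP h2]].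
  split; apply/forall_inP => f; rewrite !inE; first by case/andP.
  by rewrite negb_and => /andP[/orP[/negP//|]].
apply/setP => f; rewrite !inE; apply/andP/idP => [[fA fc]|fS].
  by apply: contraTT fc => fS; apply: h2; rewrite !inE fS.
by rewrite SA// h1.
Qed.

(** Splitting the event according to the sets of lighter elements in [A] and in
    [B] gives a double sum of [order_pattern_prob], which factors into the square
    of [bernstein_sum_subsets]. *)
Lemma few_lighter_prob (A B : {set I}) e m k : e \notin A -> e \notin B ->
  [disjoint A & B]%B -> #|A| = m -> #|B| = m ->
  comparison_mean w (fun c =>
    ((#|lighter A e c| < k)%N && (#|lighter B e c| < k)%N)%:R) =
  int01 (bernstein_sum m k ^+ 2).
Proof.
move=> eA eB AB mA mB.
pose small (X S : {set I}) := (S \subset X) && (#|S| < k)%N.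
have ind (X : {set I}) c : (#|lighter X e c| < k)%N%:R =
    \sum_(S | small X S) (lighter X e c == S)%:R :> R.
  have sX : lighter X e c \subset X.
    by apply/fintype.subsetP => f; rewrite inE => /andP[].
  have [lk|lk] := ltnP #|lighter X e c| k.
    rewrite (bigD1 (lighter X e c))/= ?eqxx ?big1 ?addr0 ?/small ?sX//.
    by move=> S /andP[_ /negbTE]; rewrite eq_sym => ->.
  rewrite big1// => S /andP[_ Sk]; case: eqP => // h.
  by move: lk; rewrite h leqNgt Sk.
transitivity (comparison_mean w (fun c => \sum_(S | small A S) \sum_(S' | small B S')
    ((lighter A e c == S) && (lighter B e c == S'))%:R)).
  apply: eq_bigr => c _; congr (_ * _); rewrite -mulnb natrM !ind mulr_suml.
  apply: eq_bigr => S _; rewrite mulr_sumr.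
  by apply: eq_bigr => S' _; rewrite -mulnb natrM.
rewrite comparison_mean_sum.
under eq_bigr do rewrite comparison_mean_sum.
rewrite expr2 -{1}mA -mB -!bernstein_sum_subsets mulr_suml linear_sum/=.
apply: eq_bigr => S /andP[SA _]; rewrite mulr_sumr linear_sum/=.
apply: eq_bigr => S' /andP[SB _].
have dS : [disjoint S & S']%B by exact: disjointW AB.
transitivity (comparison_mean w (fun c => ([forall f in (S :|: S')%SET, (f, e) \in c] &&
     [forall f in ((A :\: S) :|: (B :\: S'))%SET, (f, e) \notin c])%:R)).
  apply: eq_bigr => c _; congr (_%:R * _); congr nat_of_bool.
  rewrite !lighter_eq//; apply/idP/idP.
    case/andP => /andP[/forall_inP a1 /forall_inP a2].
    case/andP => /forall_inP b1 /forall_inP b2.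
    by apply/andP; split; apply/forall_inP => f;
      rewrite finset.in_setU => /orP[]; auto.
  case/andP => /forall_inP a /forall_inP b; rewrite -!andbA; apply/and4P.
  by split; apply/forall_inP => f h; first [apply: a|apply: b];
    rewrite finset.in_setU h ?orbT.
have dD : [disjoint A :\: S & B :\: S']%B by apply: disjointW AB; exact: subsetDl.
have card_dU (X Y : {set I}) : [disjoint X & Y]%B -> #|X :|: Y|%SET = (#|X| + #|Y|)%N.
  by move=> XY; rewrite cardsU disjoint_setI0// cards0 subn0.
have /fintype.subsetP SA' := SA; have /fintype.subsetP SB' := SB.
rewrite order_pattern_prob//.
- by rewrite !card_dU// !cardsDS// !exprD mulrACA.
- rewrite finset.in_setU negb_or; apply/andP; split.
    by apply: contra eA; exact: SA'.
  by apply: contra eB; exact: SB'.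
- by rewrite !inE negb_or !negb_and eA eB !orbT.
rewrite disjoint_subset; apply/fintype.subsetP => f; rewrite !inE => /orP[fS|fS].
- by rewrite fS/= (disjointFr AB) ?andbF// SA'.
- by rewrite fS/= (disjointFl AB) ?andbF// SB'.
Qed.

End IID2.

(** * The expected degree in the bilateral preference graph *)

Definition star {n : nat} (v : 'I_n) : {set edge n} := [set e | incident v e]%SET.

Lemma edge_endpoints {n : nat} (e : edge n) :
  exists i j : 'I_n, i != j /\ val e = [set i; j]%SET.
Proof. by have /cards2P[i [j [ij ->]]] := valP e; exists i, j. Qed.

Lemma card_star {n : nat} (v : 'I_n) : #|star v| = n.-1.
Proof.
rewrite -(card_imset _ val_inj) -[n in n.-1]card_ord -(cardsC1 v).
have inj : {in [set~ v]%SET &, injective (fun u : 'I_n => [set v; u]%SET)}.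
  move=> x y; rewrite !inE => xv yv xy.
  have : x \in [set v; y]%SET by rewrite -xy !inE eqxx orbT.
  by rewrite !inE (negbTE xv) => /eqP.
rewrite -(card_in_imset inj); congr #|pred_of_set _|; apply/setP => s.
apply/imsetP/imsetP => [[e]|[u]].
  rewrite !inE /incident => ve ->; have [i [j [ij eij]]] := edge_endpoints e.
  move: ve; rewrite eij !inE => /orP[] /eqP ->; [exists j|exists i] => //.
  - by rewrite !inE eq_sym.
  - by rewrite !inE.
  - by rewrite finset.setUC.
rewrite !inE => uv ->.
have h : (#|[set v; u]%SET| == 2)%N by rewrite cards2 [v == u]eq_sym uv.
by exists (Sub [set v; u]%SET h); rewrite ?inE /incident SubK// !inE eqxx.
Qed.

(** Membership of [e] in the graph, as a property of the order of the weights.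
    Removing [e] from the stars changes no count, as no edge is lighter than
    itself, and makes the stars of its two endpoints disjoint. *)
Definition joint_lk {n : nat} (k : nat) (e : edge n)
    (c : {set edge n * edge n}) : bool :=
  [forall v, incident v e ==> (#|lighter (star v :\ e)%SET e c| < k)%N].

Section Degree.
Context {R : realType} {n : nat} (S : LK_sample R n) (k : nat).
Let w := weight S.

Lemma LK_comparisons (omega : sample_space S) e :
  (e \in LK (fun f => w f omega) k) = joint_lk k e (comparisons w omega).
Proof.
rewrite inE /joint_lk; apply: eq_forallb => v; rewrite /among_lowest.
case: (incident v e) => //=; congr (_ < k)%N; apply: eq_card => f.
rewrite !inE/=; have [->|fe] := eqVneq f e; first by rewrite ltxx !andbF.
by [].
Qed.

Lemma joint_lk_mean e :
  comparison_mean w (fun c => (joint_lk k e c)%:R) =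
  int01 (bernstein_sum (n - 2) k ^+ 2).
Proof.
have [i [j [ij eij]]] := edge_endpoints e.
have ie : incident i e by rewrite /incident eij !inE eqxx.
have je : incident j e by rewrite /incident eij !inE eqxx orbT.
have inc v : incident v e = (v == i) || (v == j) by rewrite /incident eij !inE.
have card_rest v : incident v e -> #|star v :\ e| = (n - 2)%N.
  move=> ve; have := card_star v; rewrite (cardsD1 e) inE ve add1n.
  by move: #|_| => a; lia.
rewrite -(@few_lighter_prob _ _ _ _ _ w (weight_uniform S) (weight_independent S)
  (star i :\ e)%SET (star j :\ e)%SET e) ?card_rest ?in_setD1 ?eqxx//.
- apply: eq_bigr => c _; congr (_%:R * _); congr nat_of_bool.
  apply/forallP/andP => [h|[h1 h2] v].
    by split; [have := h i|have := h j]; rewrite ?ie ?je.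
  by apply/implyP; rewrite inc => /orP[]/eqP->.
- rewrite disjoint_subset; apply/fintype.subsetP => f; rewrite !inE => /andP[fe fi].
  rewrite fe/=; apply: contra fe => fj; apply/eqP/val_inj/esym/eqP.
  rewrite eqEcard (eqP (valP e)) (eqP (valP f)) leqnn andbT.
  by apply/fintype.subsetP => v; rewrite eij !inE => /orP[]/eqP->.
Qed.

(** The degree is a function of the finite-valued pair formed by the vertex and
    the order of the weights; their independence gives the law of this pair, and
    [card_star] makes the mean the same for every vertex. *)
Lemma expected_degreeE : (2 <= n)%N ->
  expected_degree S k = (mean_degree (n - 2) k)%:E.
Proof.
move=> n2; rewrite /expected_degree unlock.
pose Z omega := (vertex S omega, comparisons w omega).
have EZ v c : Z @^-1` [set (v, c)] =
    vertex S @^-1` [set v] `&` comparisons w @^-1` [set c].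
  by apply/seteqP; split => [omega [<- <-]|omega [/= <- <-]].
have mZ vc : measurable (Z @^-1` [set vc]).
  case: vc => v c; rewrite EZ; apply: measurableI; first exact: vertex_measurable.
  exact: measurable_comparisons.
pose deg (vc : 'I_n * {set edge n * edge n}) : R :=
  \sum_(e in star vc.1) (joint_lk k e vc.2)%:R.
transitivity (\int[sample_prob S]_omega (deg (Z omega))%:E)%E.
  apply: eq_integral => omega _; congr (_%:E).
  rewrite /random_degree /deg/= /LK_degree -sum1_card natr_sum big_mkcond/=.
  rewrite [RHS]big_mkcond/=; apply: eq_bigr => e _.
  rewrite inE LK_comparisons inE.
  by case: (joint_lk _ _ _); case: (incident _ _).
rewrite (integral_finite_valued _ _ mZ); last by move=> vc; rewrite sumr_ge0.
congr (_%:E).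
have law v c : fine (sample_prob S (Z @^-1` [set (v, c)])) =
    n%:R^-1 * comparison_law w c.
  rewrite EZ vertex_independent; last exact: sigma_of_comparisons.
  by rewrite vertex_uniform fineM ?fin_num_measure//; exact: measurable_comparisons.
transitivity (\sum_(v : 'I_n) \sum_c deg (v, c) * (n%:R^-1 * comparison_law w c)).
  by rewrite pair_bigA/=; apply: eq_bigr => -[v c] _; rewrite law.
transitivity (\sum_(v : 'I_n) n%:R^-1 * \sum_(e in star v)
    comparison_mean w (fun c => (joint_lk k e c)%:R)).
  apply: eq_bigr => v _; rewrite -comparison_mean_sum mulr_sumr.
  by apply: eq_bigr => c _; rewrite mulrCA.
under eq_bigr => v _.
  under eq_bigr do rewrite joint_lk_mean.
  rewrite sumr_const card_star; over.
rewrite sumr_const card_ord -[LHS]mulr_natl mulrA mulfV ?mul1r; last first.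
  by rewrite pnatr_eq0; lia.
by rewrite /mean_degree mulr_natl; congr (_ *+ _); lia.
Qed.

End Degree.

(** * Asymptotics *)

Section Final.
Context {R : realType} (k : nat -> nat).

Lemma littleo_sqrt_nat :
  (fun n => (k n)%:R : R) =o_\oo (fun n => Num.sqrt (n%:R : R)) ->
  \forall n \near \oo, (4 <= n)%N /\ (4 * k n <= n)%N.
Proof.
move/eqoP => ko.
have e0 : 0 < 4^-1 :> R by rewrite invr_gt0.
near=> n.
have n4 : (4 <= n)%N by near: n; exact: nbhs_infty_ge.
split => //; rewrite -(ler_nat R) natrM.
have : `|(k n)%:R| <= 4^-1 * `|Num.sqrt n%:R| :> R by near: n; exact: (ko _ e0).
rewrite !ger0_norm ?sqrtr_ge0// => h.
have n1 : 1 <= Num.sqrt n%:R :> R.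
  by rewrite -[leLHS]sqrtr1 ler_wsqrtr// ler1n; lia.
have : Num.sqrt n%:R <= n%:R :> R.
  by rewrite -[leRHS]sqr_sqrtr// expr2 ler_peMr// (le_trans _ n1).
lra.
Unshelve. all: by end_near. Qed.

Lemma littleo_cuberoot :
  (fun n => (k n)%:R : R) =o_\oo (fun n => (n%:R : R) `^ (3^-1)) ->
  forall e, 0 < e -> \forall n \near \oo, (k n)%:R ^+ 3 <= e * n%:R :> R.
Proof.
move/eqoP => ko e e0; pose del := Num.min 1 e.
(* As del <= 1, the cube of del is at most e. *)
have d0 : 0 < del by rewrite lt_min ltr01.
near=> n.
have : `|(k n)%:R| <= del * `|n%:R `^ (3^-1)| :> R by near: n; exact: (ko _ d0).
rewrite !ger0_norm ?powR_ge0// => h.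
apply: (le_trans (y := (del * n%:R `^ (3^-1)) ^+ 3)).
  by rewrite lerXn2r ?nnegrE// mulr_ge0 ?powR_ge0// ltW.
rewrite exprMn -[(_ `^ _) ^+ 3]powR_mulrn ?powR_ge0// -powRrM mulVf// powRr1//.
rewrite ler_wpM2r// (le_trans (y := del))//; last by rewrite ge_min lexx orbT.
by rewrite exprS ger_pMr// exprn_ile1 ?(ltW d0)// ge_min lexx.
Unshelve. all: by end_near. Qed.

End Final.

Theorem theorem1p2 (R : realType) (k : nat -> nat) (ED : nat -> \bar R)
  (k_ge1 : forall n, (1 <= k n)%N)
  (ED_def : forall n, (1 <= n)%N ->
     exists S : LK_sample R n, ED n = expected_degree S (k n))
  (k_small : (fun n => (k n)%:R : R) =o_\oo (fun n => Num.sqrt (n%:R : R))) :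
  (exists2 err : nat -> R,
     err =O_\oo (fun n => (k n)%:R ^+ 2 / n%:R : R) &
     \forall n \near \oo,
       ED n = ((k n)%:R
               - (2 * k n - 1)%N%:R / 2 ^+ (2 * k n - 1)
                 * 'C(2 * k n - 2, k n - 1)%:R * (1 + err n))%:E)
  /\
  ((fun n => (k n)%:R : R) =o_\oo (fun n => (n%:R : R) `^ (3^-1)) ->
   k n @[n --> \oo] --> \oo ->
   exists2 err : nat -> R,
     err =o_\oo (fun n => (Num.sqrt ((k n)%:R : R))^-1) &
     \forall n \near \oo,
       ED n = ((k n)%:R - Num.sqrt ((k n)%:R / pi)
               + (8 * Num.sqrt (pi * (k n)%:R))^-1 + err n)%:E).
Proof.
pose excess n : R := mean_degree (n - 2) (k n) - ((k n)%:R - (k n)%:R * central (k n)).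
have big := @littleo_sqrt_nat R k k_small.
have EDE n : (4 <= n)%N -> ED n = ((k n)%:R - (k n)%:R * central (k n) + excess n)%:E.
  move=> n4; have [|S ->] := ED_def n; first by lia.
  rewrite expected_degreeE; last by lia.
  by rewrite /excess addrC subrK.
have excess_bound n : (4 <= n)%N -> (4 * k n <= n)%N ->
    0 <= excess n <= 2 * ((k n)%:R ^+ 2 / n%:R).
  move=> n4 kn; have kn' : (2 * k n <= n - 2)%N by lia.
  have := @mean_degree_bounds R _ _ kn'; rewrite -/(excess n) => /andP[-> h].
  apply: (le_trans h); rewrite mulrCA ler_wpM2l ?exprn_ge0//.
  have n0 : 0 < n%:R :> R by rewrite ltr0n; lia.
  have m0 : 0 < (n - 2)%:R :> R by rewrite ltr0n; lia.
  rewrite ler_pdivlMr// ler_pdivrMl// -natrM ler_nat; lia.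
have kc0 n : 2^-1 <= (k n)%:R * central (k n) :> R.
  by have := @central_ge R (k n) (k_ge1 n); lra.
split.
  (* The constant 4 is the 2 of excess_bound over the lower bound 1/2 of kc0. *)
  exists (fun n => - (excess n / ((k n)%:R * central (k n)))).
    apply/eqO_exP; exists 4 => //; near=> n.
    have [n4 kn] : (4 <= n)%N /\ (4 * k n <= n)%N by near: n; exact: big.
    have /andP[ex0 ex] := excess_bound n n4 kn; have kc := kc0 n.
    rewrite normrN ger0_norm ?divr_ge0 ?(le_trans _ kc)//.
    rewrite ger0_norm ?divr_ge0 ?exprn_ge0// ler_pdivrMr; last first.
      by apply: lt_le_trans kc; rewrite invr_gt0.
    apply: (le_trans ex); set t := _ / _; set q := _ * _ in kc *.
    have t0 : 0 <= t by rewrite divr_ge0// exprn_ge0.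
    have -> : 2 * t = 4 * t * 2^-1 by field.
    by rewrite ler_wpM2l// mulr_ge0.
  near=> n.
  have [n4 kn] : (4 <= n)%N /\ (4 * k n <= n)%N by near: n; exact: big.
  rewrite (EDE n n4) centralE//; congr (_%:E); have kc := kc0 n.
  have kcn : (k n)%:R * central (k n) != 0 :> R by apply/lt0r_neq0/(lt_le_trans _ kc).
  by move: (_ * central _) (excess n) kcn => q x qn; field.
move=> k_cuberoot koo; have k3 := @littleo_cuberoot R k k_cuberoot.
exists (fun n => excess n - ((k n)%:R * central (k n) - Num.sqrt ((k n)%:R / pi)
     + (8 * Num.sqrt (pi * (k n)%:R))^-1)).
  apply/eqoP => e e0; have e4 : 0 < e / 4 by rewrite divr_gt0.
  pose K := (Num.truncn (2 / e)).+1.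
  have kK : \forall n \near \oo, (K <= k n)%N.
    exact: (koo [set x | (K <= x)%N] (nbhs_infty_ge K)).
  near=> n.
  have [n4 kn] : (4 <= n)%N /\ (4 * k n <= n)%N by near: n; exact: big.
  have /andP[ex0 ex] := excess_bound n n4 kn.
  have k3n : (k n)%:R ^+ 3 <= e / 4 * n%:R by near: n; exact: (k3 _ e4).
  have kbig : 2 / e <= (k n)%:R.
    have : (K <= k n)%N by near: n; exact: kK.
    rewrite -(ler_nat R) => trunc_le; apply: le_trans trunc_le.
    exact: ltW (truncnS_gt _).
  have := @central_expansion R (k n) (k_ge1 n); set a := _ + _^-1 => ha.
  have k1 : 1 <= (k n)%:R :> R by rewrite ler1n.
  have n0 : 0 < n%:R :> R by rewrite ltr0n; lia.
  have r1 : 1 <= Num.sqrt (k n)%:R :> R by rewrite -[leLHS]sqrtr1 ler_wsqrtr.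
  have r2 : Num.sqrt (k n)%:R ^+ 2 = (k n)%:R :> R by rewrite sqr_sqrtr.
  move: ha r1 r2; set r := Num.sqrt (k n)%:R.
  set x := (k n)%:R in k1 kbig k3n ex * => ha r1 r2.
  apply: (le_trans (ler_normB _ _)); rewrite (ger0_norm ex0).
  have r0 : 0 < r by lra.
  have i0 : 0 < r^-1 by rewrite invr_gt0.
  rewrite (ger0_norm (ltW i0)).
  have b1 : excess n <= e / 2 * r^-1.
    apply: (le_trans ex); rewrite ler_pdivlMr//.
    have -> : 2 * (x ^+ 2 / n%:R) * r = 2 * (x ^+ 2 * r) / n%:R.
      by field; rewrite gt_eqF.
    rewrite ler_pdivrMr//.
    have : x ^+ 2 * r <= x ^+ 3.
      rewrite [leRHS]exprSr ler_wpM2l ?exprn_ge0//.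
      by rewrite -r2 expr2 ler_peMr// ltW.
    by lra.
  have b2 : `|a| <= e / 2 * r^-1.
    apply: (le_trans ha); rewrite invfM ler_wpM2r ?(ltW i0)//.
    by rewrite -[e / 2]invrK lef_pV2 ?posrE ?invr_gt0 ?divr_gt0 ?invf_div//; lra.
  by lra.
near=> n.
have [n4 kn] : (4 <= n)%N /\ (4 * k n <= n)%N by near: n; exact: big.
by rewrite (EDE n n4); congr (_%:E); ring.
Unshelve. all: by end_near. Qed.
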